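(* Let $K=\mathbb C$, $V$ a finite-dimensional $K$-vector space, $G\leqslant\mathrm{GL}(V)$ a finite pseudo-reflection group, $S=\mathrm{Sym}_K(V)$ and $R=S^G$. Let $U\subset S$ be the space of $G$-harmonic polynomials and let $x\in U$ be such that $\{x_g:=g(x)\mid g\in G\}$ is a $K$-basis of $U$. Then the matrix $(X_{g,h})_{g,h\in G}$ of the $S$-linear map $\varphi:S\otimes_RS\to\mathrm{Maps}(G,S)$, $\varphi(a\otimes b)(g)=a\,g(b)$, with respect to the $S$-bases $\{1\otimes x_{h^{-1}}\mid h\in G\}$ of $S\otimes_RS$ and $\{\delta_g\mid g\in G\}$ of $\mathrm{Maps}(G,S)$, is the group matrix $\mathbb M$ of $G$ evaluated at the harmonic polynomials $x_g\in S$, $g\in G$; that is, $X_{g,h}=x_{gh^{-1}}$.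
   Context: $G$ acts on $S=K[x_1,\dots,x_n]$ by algebra automorphisms extending its action on $V$; a pseudo-reflection group is generated by elements conjugate to $\mathrm{diag}(\zeta,1,\dots,1)$, $\zeta\ne1$ a root of unity. $R=K[f_1,\dots,f_n]$ with homogeneous basic invariants. The space $U$ of $G$-harmonic polynomials is the $K$-span of all (higher) partial derivatives of the Jacobian $J=\det(\partial f_i/\partial x_j)$; it is $G$-stable, isomorphic to the regular representation $KG$, complementary to the ideal of $S$ generated by the positive-degree invariants, and multiplication $R\otimes_KU\to S$ is an isomorphism, so elements $x$ as in the claim exist. The group matrix of $G$ is $\mathbb M=(x_{gh^{-1}})_{g,h\in G}$ with entries in the polynomial ring in variables $x_g$, $g\in G$. $S$ acts on $S\otimes_RS$ through the first factor, on $\mathrm{Maps}(G,S)$ pointwise; $\delta_g$ is the map with value $1$ at $g$ and $0$ elsewhere. *)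

(* Defs.v *)
From HB Require Import structures.
From mathcomp Require Import all_boot all_order all_algebra all_fingroup.
From mathcomp Require Import generic_quotient ring_quotient mxrepresentation.
From mathcomp Require Import mpoly freeg.
From mathcomp Require Import boolp reals complex.

Set Implicit Arguments.
Unset Strict Implicit.
Unset Printing Implicit Defensive.

Import GRing.Theory.
Local Open Scope ring_scope.
Local Open Scope quotient_scope.

(** * Families and matrices of linear maps *)

Section Bases.
Variables (A : pzRingType) (I : finType).

(* [b] is an [A]-basis of the submodule [P] of [M], as an indexed family. *)
Definition is_basis (M : lmodType A) (P : M -> Prop) (b : I -> M) : Prop :=
  [/\ forall i, P (b i),
      forall c : I -> A, \sum_i c i *: b i = 0 -> forall i, c i = 0
    & forall m, P m -> exists c : I -> A, m = \sum_i c i *: b i].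

(* The column of index [j] of [X] lists the coordinates of [phi (b j)]. *)
Definition is_matrix_of (M N : lmodType A) (phi : {linear M -> N})
    (b : I -> M) (d : I -> N) (X : I -> I -> A) : Prop :=
  [/\ is_basis (fun _ => True) b, is_basis (fun _ => True) d
    & forall j, phi (b j) = \sum_i X i j *: d i].

End Bases.

(** * The [S]-module [S (x)_R S] for a subring [R] of a commutative ring [S] *)

Section Tensor.
Variables (S : comNzRingType) (R : {pred S}).

(* [<< a *g b >>] in the free [S]-module on the set [S] stands for [a (x) b];
   the relations below are those of extension of scalars from [R] to [S], so
   [S] acts through the first factor. *)
Inductive tensor_rel : {freeg S / S} -> Prop :=
| TensorRelD b b' : tensor_rel (<< b + b' >> - << b >> - << b' >>)
| TensorRelZ r b : r \in R -> tensor_rel (<< r * b >> - r *: << b >>)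
| TensorRel0 : tensor_rel 0
| TensorRelAdd u v : tensor_rel u -> tensor_rel v -> tensor_rel (u + v)
| TensorRelScale a u : tensor_rel u -> tensor_rel (a *: u).

Definition tensor_relb : {pred {freeg S / S}} := fun u => `[< tensor_rel u >].

Lemma tensor_rel_zmod : zmod_closed tensor_relb.
Proof.
split=> [|u v /asboolP hu /asboolP hv]; apply/asboolP; first exact: TensorRel0.
by rewrite -scaleN1r; apply/TensorRelAdd/TensorRelScale.
Qed.

HB.instance Definition _ :=
  GRing.isZmodClosed.Build {freeg S / S} tensor_relb tensor_rel_zmod.

Definition tensor : Type := Quotient.quot tensor_relb.
HB.instance Definition _ := GRing.Zmodule.on tensor.

Definition tensor_pi (u : {freeg S / S}) : tensor :=
  \pi_(Quotient.quot tensor_relb) u.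

Lemma tensor_piP u v : tensor_pi u = tensor_pi v <-> tensor_rel (u - v).
Proof.
rewrite /tensor_pi; split=> [/eqP|huv].
  by rewrite -Quotient.idealrBE => /asboolP.
by apply/eqP; rewrite -Quotient.idealrBE; apply/asboolP.
Qed.

Lemma tensor_piD u v : tensor_pi (u + v) = tensor_pi u + tensor_pi v.
Proof. by rewrite /tensor_pi [LHS]raddfD. Qed.

Lemma tensor_piK (t : tensor) : tensor_pi (repr t) = t.
Proof. exact: reprK. Qed.

Definition tensor_scale (a : S) (t : tensor) : tensor :=
  tensor_pi (a *: repr t).

Lemma tensor_scaleE a u : tensor_scale a (tensor_pi u) = tensor_pi (a *: u).
Proof.
apply/tensor_piP; rewrite -scalerBr; apply: TensorRelScale.
by apply/tensor_piP; rewrite tensor_piK.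
Qed.

Lemma tensor_scaleA a b t :
  tensor_scale a (tensor_scale b t) = tensor_scale (a * b) t.
Proof. by rewrite -[t]tensor_piK !tensor_scaleE scalerA. Qed.

Lemma tensor_scale1 : left_id 1 tensor_scale.
Proof. by move=> t; rewrite -[t]tensor_piK tensor_scaleE scale1r. Qed.

Lemma tensor_scaleDr : right_distributive tensor_scale +%R.
Proof.
move=> a t u; rewrite -[t]tensor_piK -[u]tensor_piK.
by rewrite -tensor_piD !tensor_scaleE scalerDr tensor_piD.
Qed.

Lemma tensor_scaleDl t : {morph tensor_scale^~ t : a b / a + b}.
Proof.
move=> a b; rewrite -[t]tensor_piK.
by rewrite !tensor_scaleE scalerDl tensor_piD.
Qed.

HB.instance Definition _ := GRing.Zmodule_isLmodule.Build S tensor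
  tensor_scaleA tensor_scale1 tensor_scaleDr tensor_scaleDl.

Definition tens (a b : S) : tensor := tensor_pi << a *g b >>.

Lemma tensE a b : tens a b = a *: tens 1 b.
Proof.
rewrite -[RHS]/(tensor_scale _ _) tensor_scaleE /tens; congr tensor_pi.
by apply/eqP/freeg_eqP => z; rewrite coeffZ !coeffU mul1r.
Qed.

Lemma tensDl a a' b : tens (a + a') b = tens a b + tens a' b.
Proof. by rewrite /tens -freegUD tensor_piD. Qed.

Lemma tensDr a b b' : tens a (b + b') = tens a b + tens a b'.
Proof.
rewrite (tensE a (b + b')) (tensE a b) (tensE a b') -scalerDr; congr (_ *: _).
rewrite /tens -tensor_piD; apply/tensor_piP; rewrite opprD addrA.
exact: TensorRelD.
Qed.

Lemma tens_balanced r a b : r \in R -> tens (a * r) b = tens a (r * b).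
Proof.
move=> rR; rewrite (tensE (a * r)) (tensE a (r * b)) -scalerA; congr (_ *: _).
by symmetry; rewrite -[RHS]/(tensor_scale _ _) tensor_scaleE;
  apply/tensor_piP/TensorRelZ.
Qed.

Section Lift.
Variables (M : lmodType S) (psi : S -> M).
Hypothesis psiD : {morph psi : b b' / b + b'}.
Hypothesis psiZ : forall r b, r \in R -> psi (r * b) = r *: psi b.

Fact fglift_zmod_morphism : zmod_morphism (fglift psi : {freeg S / S} -> M).
Proof. exact: lift_is_additive. Qed.

HB.instance Definition _ := GRing.isZmodMorphism.Build {freeg S / S} M
  (fglift psi) fglift_zmod_morphism.

Lemma fgliftZ a (u : {freeg S / S}) : fglift psi (a *: u) = a *: fglift psi u.
Proof.
have scaleU c b : a *: << c *g b >> = << (a * c) *g b >> :> {freeg S / S}.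
  by apply/eqP/freeg_eqP => z; rewrite coeffZ !coeffU mulrA.
rewrite -[u]freeg_sumE scaler_sumr !raddf_sum.
by apply: eq_bigr => b _; rewrite /= scaleU !liftU scalerA.
Qed.

Lemma fglift_tensor_rel u : tensor_rel u -> fglift psi u = 0.
Proof.
elim=> [b b'|r b rR||v w _ hv _ hw|a v _ hv].
- by rewrite !raddfB /= !liftU !scale1r psiD addrAC addrK subrr.
- by rewrite raddfB /= fgliftZ !liftU !scale1r psiZ // subrr.
- exact: raddf0.
- by rewrite raddfD /= hv hw addr0.
- by rewrite fgliftZ hv scaler0.
Qed.

Definition tensor_lift (t : tensor) : M := fglift psi (repr t).

Lemma tensor_lift_pi u : tensor_lift (tensor_pi u) = fglift psi u.
Proof.
apply/subr0_eq; rewrite /tensor_lift -raddfB; apply: fglift_tensor_rel.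
by apply/tensor_piP; rewrite tensor_piK.
Qed.

Lemma tensor_lift_tens a b : tensor_lift (tens a b) = a *: psi b.
Proof. by rewrite tensor_lift_pi liftU. Qed.

Lemma tensor_lift_linear : linear tensor_lift.
Proof.
move=> a t u; rewrite -[t]tensor_piK -[u]tensor_piK.
rewrite -[_ *: _]/(tensor_scale _ _) tensor_scaleE -tensor_piD.
by rewrite !tensor_lift_pi raddfD /= fgliftZ.
Qed.

End Lift.

End Tensor.

(** * Reflection groups acting on the symmetric algebra *)

(* A finite subgroup of GL(V), V = K^n, is given as the image of a faithful
   representation [rG] of a finite group, acting on the left on column vectors.
   Sym(V) is [{mpoly K[n]}], the variable ['X_i] being the i-th basis vector. *)
Section Reflection.
Variables (K : fieldType) (n : nat) (gT : finGroupType).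
Variable rG : mx_representation K [set: gT] n.
Local Notation S := {mpoly K[n]}.

Definition pseudo_reflection (M : 'M[K]_n) : Prop :=
  exists (zeta : K) (P : 'M[K]_n),
    [/\ (0 < n)%N, zeta != 1, exists2 m, (0 < m)%N & zeta ^+ m = 1,
        P \in unitmx
      & M = P *m diag_mx (\row_(i < n) (if i == 0%N :> nat then zeta else 1))
              *m invmx P].

Definition reflection_group : Prop :=
  exists2 A : {set gT}, forall g, g \in A -> pseudo_reflection (rG g)
    & (<<A>> = [set: gT])%g.

Definition sym_act (g : gT) (p : S) : S :=
  p \mPo [tuple \sum_(i < n) rG g i j *: 'X_i | j < n].

Lemma sym_actD g p q : sym_act g (p + q) = sym_act g p + sym_act g q.
Proof. exact: raddfD. Qed.

Lemma sym_actM g p q : sym_act g (p * q) = sym_act g p * sym_act g q.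
Proof. exact: rmorphM. Qed.

Definition invariants : {pred S} := [pred p | [forall g, sym_act g p == p]].

Definition basic_invariants (f : n.-tuple S) : Prop :=
  [/\ forall i, exists d, tnth f i \is d.-homog,
      forall i, tnth f i \in invariants,
      forall p, p \in invariants -> exists q : S, p = q \mPo f
    & forall q : S, q \mPo f = 0 -> q = 0].

Definition jacobian (f : n.-tuple S) : S :=
  \det (\matrix_(i < n, j < n) (tnth f i)^`M(j)).

(* The span of all the partial derivatives, including the one of order 0. *)
Definition harmonic (f : n.-tuple S) (u : S) : Prop :=
  exists (s : seq 'X_{1..n}) (c : 'X_{1..n} -> K),
    u = \sum_(m <- s) c m *: (jacobian f)^`M[m].

Definition orbit_map (b : S) : {ffun gT -> S^o} :=
  [ffun g => sym_act g b : S^o].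

Lemma orbit_mapD : {morph orbit_map : b b' / b + b'}.
Proof. by move=> b b'; apply/ffunP => g; rewrite !ffunE sym_actD. Qed.

Lemma orbit_mapZ r b :
  r \in invariants -> orbit_map (r * b) = r *: orbit_map b.
Proof.
by move=> /forallP rR; apply/ffunP => g;
  rewrite !ffunE sym_actM (eqP (rR g)).
Qed.

Definition phi_fun : tensor invariants -> {ffun gT -> S^o} :=
  tensor_lift orbit_map.

HB.instance Definition _ := GRing.isLinear.Build S (tensor invariants)
  {ffun gT -> S^o} _ phi_fun (tensor_lift_linear orbit_mapD orbit_mapZ).

Definition phi : {linear tensor invariants -> {ffun gT -> S^o}} := phi_fun.

Lemma phiE a b g : phi (tens invariants a b) g = a * sym_act g b.
Proof.
rewrite [LHS](congr1 (fun u : {ffun gT -> S^o} => u g)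
  (tensor_lift_tens orbit_mapD orbit_mapZ a b)).
by rewrite !ffunE.
Qed.

Definition delta (g : gT) : {ffun gT -> S^o} := [ffun h => (h == g)%:R : S^o].

(* The variable x_g of the generic group matrix is ['X_(enum_rank g)]. *)
Definition group_matrix (g h : gT) : {mpoly K[#|gT|]} :=
  'X_(enum_rank (g * h^-1)%g).

Definition group_matrix_eval (y : gT -> S) (g h : gT) : S :=
  group_matrix g h \mPo [tuple y (enum_val i) | i < #|gT|].

End Reflection.

(* Main.v *)
(** Let [R] be the ring of invariants, [I] the ideal of [S] generated by the
    invariants without constant term, and [U] the harmonic polynomials.
    - Chevalley's argument, run locally at the origin so that no grading is
      needed, shows that elements of [S] which are [K]-independent modulo [I]
      are [R]-independent; averaging over [G] shows that [|G| + 1] elements of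
      [S] are always [R]-dependent.
    - [U] meets [I] trivially: after a change of coordinates making [G] unitary,
      the Fischer product [conj(p)(d) q (0)] is definite, and [I] is orthogonal
      to [U] as soon as the invariant differential operators without constant
      term kill the Jacobian.  They do: such an operator maps the Jacobian to
      an element of [U] of smaller degree with the same character of [G], and
      this character occurs only once in [U], which the orbit of [x] identifies
      with the regular representation.
    - So the [|G|] elements [g x] are [R]-independent, they span [S] modulo [I],
      and by induction on the degree they form an [R]-basis of [S]. *)
Require Import Defs.
From mathcomp Require Import all_boot all_order all_algebra all_fingroup.
From mathcomp Require Import mxrepresentation mpoly reals complex.
From HB Require Import structures.
From mathcomp Require Import ssrcomplements freeg boolp spectral.

Set Implicit Arguments.
Unset Strict Implicit.
Unset Printing Implicit Defensive.

Import Order.TTheory GRing.Theory Num.Theory.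
Local Open Scope ring_scope.

(** * Linear substitutions and constant coefficient differential operators *)

Section Operators.
Variables (K : fieldType) (n : nat).
Local Notation S := {mpoly K[n]}.
Implicit Types (M N : 'M[K]_n) (p q u : S).

Lemma mpoly_alg_ind (P : S -> Prop) :
  (forall c, P c%:MP) -> (forall i, P 'X_i) ->
  (forall p q, P p -> P q -> P (p + q)) ->
  (forall p q, P p -> P q -> P (p * q)) ->
  forall p, P p.
Proof.
move=> PC PX PD PM p; rewrite [p]mpolyE.
have P0 : P 0 by rewrite -mpolyC0.
elim/big_ind: _ => // m _; rewrite -mul_mpolyC; apply: (PM) => //.
rewrite mpolyXE_id; elim/big_ind: _ => //; first by rewrite -mpolyC1.
move=> i _; elim: (m i) => [|k IH]; first by rewrite expr0 -mpolyC1.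
by rewrite exprS; apply: PM.
Qed.

(** The substitution behind [sym_act], freed from the group: changes of coordinates and transposed
    matrices are substituted too. *)
Definition msubst M : S -> S :=
  comp_mpoly [tuple \sum_(i < n) M i j *: 'X_i | j < n].

Arguments msubst : simpl never.

HB.instance Definition _ M := GRing.RMorphism.copy (msubst M) (msubst M).
HB.instance Definition _ M := GRing.Linear.copy (msubst M) (msubst M).

Lemma msubstX M j : msubst M 'X_j = \sum_(i < n) M i j *: 'X_i.
Proof. by rewrite /msubst comp_mpolyXU -tnth_nth tnth_mktuple. Qed.

Lemma msubstC M c : msubst M c%:MP = c%:MP.
Proof. exact: comp_mpolyC. Qed.

Lemma msubst_comp M N p : msubst M (msubst N p) = msubst (M *m N) p.
Proof.
elim/mpoly_alg_ind: p => [c|j|p q IHp IHq|p q IHp IHq].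
- by rewrite !msubstC.
- rewrite !msubstX linear_sum /=.
  under eq_bigr do rewrite linearZ /= msubstX scaler_sumr.
  rewrite exchange_big; apply: eq_bigr => k _; rewrite mxE scaler_suml.
  by apply: eq_bigr => i _; rewrite scalerA mulrC.
- by rewrite !rmorphD /= IHp IHq.
- by rewrite !rmorphM /= IHp IHq.
Qed.

Lemma msubst1 p : msubst 1%:M p = p.
Proof.
rewrite -[RHS]comp_mpoly_id /msubst; congr comp_mpoly.
apply: eq_from_tnth => j; rewrite !tnth_mktuple (bigD1 j) //= big1 ?addr0.
  by rewrite mxE eqxx scale1r.
by move=> i /negbTE ij; rewrite mxE ij scale0r.
Qed.

Lemma msubst_inj M : M \in unitmx -> injective (msubst M).
Proof.
move=> uM; apply: (can_inj (g := msubst (invmx M))) => p.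
by rewrite msubst_comp mulVmx // msubst1.
Qed.

Lemma msubst_homogX M m : msubst M 'X_[m] \is (mdeg m).-homog.
Proof.
rewrite mpolyXE_id rmorph_prod mdegE /=.
elim/big_rec2: _ => [|i d q _ hq]; first exact: dhomog1.
have hi : msubst M 'X_i \is 1.-homog.
  rewrite msubstX rpred_sum // => j _; rewrite rpredZ // dhomogX.
  by rewrite /= mdeg1.
apply: dhomogM => //; rewrite rmorphXn.
by have := dhomogMn (m i) hi; rewrite mul1n.
Qed.

Lemma pihomog_msubst M d p :
  pihomog mdeg d (msubst M p) = msubst M (pihomog mdeg d p).
Proof.
elim/mpolyind: p => [|c m p _ _ IHp]; first by rewrite !raddf0.
rewrite !linearP /= IHp; congr (_ *: _ + _); rewrite pihomogX.
have [<-|ne] := eqVneq (mdeg m) d.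
  exact/pihomog_dE/msubst_homogX.
by rewrite raddf0 (pihomog_ne0 ne (msubst_homogX M m)).
Qed.

Lemma mcoeff0M p q : (p * q)@_0 = p@_0 * q@_0.
Proof. exact: rmorphM. Qed.

Lemma msubst_mcoeff0 M p : (msubst M p)@_0 = p@_0.
Proof.
elim/mpoly_alg_ind: p => [c|j|p q IHp IHq|p q IHp IHq].
- by rewrite msubstC.
- rewrite msubstX raddf_sum /= mcoeffX mnm1_eq0 big1 // => i _.
  by rewrite mcoeffZ mcoeffX mnm1_eq0 mulr0.
- by rewrite rmorphD /= !mcoeffD IHp IHq.
- by rewrite rmorphM /= !mcoeff0M IHp IHq.
Qed.

(** This is $p(\partial)u$, the constant coefficient operator with symbol [p]. *)
Definition dop p u : S := \sum_(m <- msupp p) p@_m *: u^`M[m].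

(** Supports vary with the symbol; a degree bound gives different symbols one common index set. *)
Lemma dopwE k p u : (msize p <= k)%N ->
  dop p u = \sum_(m : 'X_{1..n < k}) p@_m *: u^`M[m].
Proof.
move=> le_pk; pose I : subFinType _ := 'X_{1..n < k}.
rewrite /dop (big_mksub I) /=; first last.
  by move=> x /msize_mdeg_lt/leq_trans/(_ le_pk).
  by rewrite msupp_uniq.
by rewrite big_rmcond //= => j /memN_msupp_eq0 ->; rewrite scale0r.
Qed.

Lemma dop_is_linear p : linear (dop p).
Proof.
move=> c u v; rewrite /dop scaler_sumr -big_split /=; apply: eq_bigr => m _.
by rewrite linearP scalerDr !scalerA mulrC.
Qed.

HB.instance Definition _ p := GRing.isLinear.Build K S S _ (dop p)
  (dop_is_linear p).

Lemma dopD p q u : dop (p + q) u = dop p u + dop q u.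
Proof.
pose k := maxn (msize (p + q)) (maxn (msize p) (msize q)).
rewrite !(@dopwE k) ?leq_max ?leqnn ?orbT // -big_split /=.
by apply: eq_bigr => m _; rewrite mcoeffD scalerDl.
Qed.

Lemma dopZ c p u : dop (c *: p) u = c *: dop p u.
Proof.
pose k := maxn (msize (c *: p)) (msize p).
rewrite !(@dopwE k) ?leq_max ?leqnn ?orbT // scaler_sumr /=.
by apply: eq_bigr => m _; rewrite mcoeffZ scalerA.
Qed.

Lemma dop0 u : dop 0 u = 0.
Proof. by rewrite /dop big1 // => m _; rewrite mcoeff0 scale0r. Qed.

Lemma dop_sum (I : Type) (r : seq I) (F : I -> S) u :
  dop (\sum_(i <- r) F i) u = \sum_(i <- r) dop (F i) u.
Proof.
by apply: (big_morph (dop^~ u)) => [p q|]; rewrite ?dopD ?dop0.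
Qed.

Lemma dopXm m u : dop 'X_[m] u = u^`M[m].
Proof. by rewrite /dop msuppX big_seq1 mcoeffX eqxx scale1r. Qed.

Lemma dopX i u : dop 'X_i u = u^`M(i).
Proof. by rewrite dopXm mderivmU1m. Qed.

Lemma dopC c u : dop c%:MP u = c *: u.
Proof. by rewrite -[c%:MP]mulr1 mul_mpolyC dopZ -mpolyX0 dopXm mderivm0m. Qed.

Lemma dopM p q u : dop (p * q) u = dop p (dop q u).
Proof.
elim/mpoly_alg_ind: p q u => [c|i|p p' IHp IHq|p p' IHp IHq] q u.
- by rewrite mul_mpolyC dopZ dopC.
- rewrite [q]mpolyE mulr_sumr !dop_sum linear_sum; apply: eq_bigr => m _ /=.
  rewrite -scalerAr !dopZ linearZ /= -mpolyXD !dopXm addmC.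
  by rewrite mderivmDm.
- by rewrite mulrDl !dopD IHp IHq.
- by rewrite -mulrA !IHp IHq.
Qed.

Lemma mderiv_msubst M k u :
  (msubst M u)^`M(k) = msubst M (\sum_(j < n) M k j *: u^`M(j)).
Proof.
have XU (i j : 'I_n) : ('X_i : S)^`M(j) = (i == j)%:R%:MP.
  rewrite mderivX mnmE; case: eqP => [->|_]; last by rewrite scale0r mpolyC0.
  rewrite scale1r mpolyC1 -mpolyX0; congr 'X_[_].
  by apply/mnmP => l; rewrite mnmBE subnn mnm0E.
elim/mpoly_alg_ind: u => [c|j|p q IHp IHq|p q IHp IHq].
- rewrite msubstC mderivC big1 ?rmorph0 // => j _.
  by rewrite mderivC scaler0.
- rewrite msubstX linear_sum /=.
  under eq_bigr do rewrite mderivZ XU.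
  under [in RHS]eq_bigr do rewrite XU.
  rewrite (bigD1 k) //= [in RHS](bigD1 j) //= !eqxx !big1.
  + by rewrite !addr0 linearZ /= msubstC.
  + by move=> i ij; rewrite eq_sym (negbTE ij) mpolyC0 scaler0.
  + by move=> i ij; rewrite (negbTE ij) mpolyC0 scaler0.
- rewrite rmorphD mderivD /= IHp IHq -rmorphD -big_split /=; congr msubst.
  by apply: eq_bigr => j _; rewrite mderivD scalerDr.
- rewrite rmorphM mderivM /= IHp IHq -!rmorphM -rmorphD /=; congr msubst.
  rewrite mulr_suml mulr_sumr -big_split /=.
  by apply: eq_bigr => j _; rewrite mderivM scalerDr scalerAl scalerAr.
Qed.

(** The chain rule settles the case where [p] is a variable, and both sides are compatible with sums
    and products in [p]. Symbols thus transform by the transpose. *)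
Lemma dop_msubst M p u :
  dop p (msubst M u) = msubst M (dop (msubst M^T p) u).
Proof.
elim/mpoly_alg_ind: p u => [c|k|p q IHp IHq|p q IHp IHq] u.
- by rewrite msubstC !dopC linearZ.
- rewrite dopX mderiv_msubst msubstX dop_sum; congr msubst.
  by apply: eq_bigr => j _; rewrite dopZ dopX mxE.
- by rewrite rmorphD !dopD /= IHp IHq rmorphD.
- by rewrite rmorphM !dopM /= IHq IHp.
Qed.

Lemma harmonicP (f : n.-tuple S) u :
  harmonic f u <-> exists p, u = dop p (jacobian f).
Proof.
split=> [[s [c ->]]|[p ->]]; last by exists (msupp p), (fun m => p@_m).
exists (\sum_(m <- s) c m *: 'X_[m]); rewrite dop_sum.
by apply: eq_bigr => m _; rewrite dopZ dopXm.
Qed.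

Lemma msize_mderiv i u : u != 0 -> (msize u^`M(i) < msize u)%N.
Proof.
move=> u0; rewrite ltnNge; apply/negP => le_u.
have d0 : u^`M(i) != 0.
  rewrite -msize_poly_eq0 -lt0n; apply: leq_trans le_u.
  by rewrite lt0n msize_poly_eq0.
have := mlead_supp d0; rewrite mcoeff_msupp mcoeff_deriv.
rewrite memN_msupp_eq0 ?mul0rn ?eqxx // msize_mdeg_ge // mdegD mdeg1.
by rewrite addn1 mlead_deg.
Qed.

(** Every monomial of [p] contains some variable, so its operator factors through a first
    derivative, which strictly lowers the size; the other factors do not raise it. *)
Lemma dop_lower p u : p@_0 = 0 -> u != 0 -> (msize (dop p u) < msize u)%N.
Proof.
have dle q v : (msize (dop q v) <= msize v)%N.
  elim/mpoly_alg_ind: q v => [c|k|p1 p2 IHp IHq|p1 p2 IHp IHq] v.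
  - by rewrite dopC msizeZ_le.
  - rewrite dopX; have [->|v0] := eqVneq v 0; first by rewrite mderiv0.
    exact/ltnW/msize_mderiv.
  - by rewrite dopD (leq_trans (msizeD_le _ _)) // geq_max IHp IHq.
  - by rewrite dopM (leq_trans (IHp _)).
have [->|p0 p00 u0] := eqVneq p 0.
  by rewrite dop0 msize0 lt0n msize_poly_eq0.
rewrite /dop big_seq; elim/big_ind: _ => [|q r hq hr|m mp].
- by rewrite msize0 lt0n msize_poly_eq0.
- by rewrite (leq_ltn_trans (msizeD_le _ _)) // gtn_max hq hr.
rewrite (leq_ltn_trans (msizeZ_le _ _)) // -dopXm.
have [i mi] : exists i, m i != 0%N.
  apply/existsP; rewrite -negb_forall; apply: contraTN mp => /forallP m0.
  suff -> : m = 0%MM by rewrite mcoeff_msupp p00 eqxx.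
  by apply/mnmP => i; rewrite mnmE; apply/eqP/m0.
have im : (U_(i) <= m)%MM by rewrite lep1mP.
rewrite -(submK im) mpolyXD dopM dopX.
by rewrite (leq_ltn_trans (dle _ _)) ?msize_mderiv.
Qed.

End Operators.

(** * Invariants and reflections *)

Section Invariants.
Variables (C : numClosedFieldType) (n : nat) (gT : finGroupType).
Variable rG : mx_representation C [set: gT] n.
Local Notation S := {mpoly C[n]}.
Local Notation act := (sym_act rG).
Local Notation R := (invariants rG).
Implicit Types (g h : gT) (p q r : S).

Lemma sym_actE g p : act g p = msubst (rG g) p.
Proof. by []. Qed.

HB.instance Definition _ g :=
  GRing.RMorphism.copy (sym_act rG g) (msubst (rG g)).
HB.instance Definition _ g :=
  GRing.Linear.copy (sym_act rG g) (msubst (rG g)).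

Lemma sym_act1 p : act 1%g p = p.
Proof. by rewrite sym_actE repr_mx1 msubst1. Qed.

Lemma sym_act_comp g h p : act g (act h p) = act (g * h)%g p.
Proof. by rewrite !sym_actE msubst_comp repr_mxM ?inE. Qed.

Lemma sym_act_inj g : injective (act g).
Proof.
apply: (can_inj (g := act g^-1%g)) => p.
by rewrite sym_act_comp mulVg sym_act1.
Qed.

Lemma sym_act_mcoeff0 g p : (act g p)@_0 = p@_0.
Proof. exact: msubst_mcoeff0. Qed.

Lemma invariantsP p : reflect (forall g, act g p = p) (p \in R).
Proof. by apply: (iffP forallP) => h g; apply/eqP/h. Qed.

Fact invariants_subalg : subalg_closed R.
Proof.
split; first by apply/invariantsP => g; rewrite rmorph1.
- move=> a p q /invariantsP hp /invariantsP hq; apply/invariantsP => g.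
  by rewrite linearP /= hp hq.
- move=> p q /invariantsP hp /invariantsP hq; apply/invariantsP => g.
  by rewrite rmorphM /= hp hq.
Qed.

HB.instance Definition _ := GRing.isSubalgClosed.Build C S (invariants rG)
  invariants_subalg.

Lemma sum_orbit_invariant p : \sum_g act g p \in R.
Proof.
apply/invariantsP => h; rewrite linear_sum /= [RHS](reindex_inj (mulgI h)) /=.
by apply: eq_bigr => g _; rewrite sym_act_comp.
Qed.

Lemma prod_orbit_invariant p : \prod_g act g p \in R.
Proof.
apply/invariantsP => h; rewrite rmorph_prod /= [RHS](reindex_inj (mulgI h)) /=.
by apply: eq_bigr => g _; rewrite sym_act_comp.
Qed.

Lemma pihomog_invariant d p : p \in R -> pihomog mdeg d p \in R.
Proof.
move=> /invariantsP hp; apply/invariantsP => g.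
by rewrite sym_actE -pihomog_msubst -sym_actE hp.
Qed.

Definition reynolds p : S := #|gT|%:R^-1 *: \sum_g act g p.

Lemma card_group_neq0 : #|gT|%:R != 0 :> C.
Proof. by rewrite pnatr_eq0 -lt0n -cardsT cardG_gt0. Qed.

Lemma reynolds_invariant p : reynolds p \in R.
Proof. by rewrite rpredZ // sum_orbit_invariant. Qed.

Lemma reynolds_mulr (J : finType) (r p : J -> S) :
  (forall j, r j \in R) ->
  reynolds (\sum_j r j * p j) = \sum_j r j * reynolds (p j).
Proof.
move=> rR; rewrite /reynolds.
under eq_bigr do rewrite linear_sum /=.
rewrite exchange_big scaler_sumr; apply: eq_bigr => j _.
rewrite -scalerAr; congr (_ *: _); rewrite mulr_sumr; apply: eq_bigr => g _.
by rewrite rmorphM /= (invariantsP _ (rR j)).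
Qed.

(** Generators carry an arbitrary cofactor [q], so closure under sums suffices and inductions have
    one substantial case, a product [r * q]. *)
Inductive coinv_ideal : S -> Prop :=
| CoinvIdeal0 : coinv_ideal 0
| CoinvIdealD p q : coinv_ideal p -> coinv_ideal q -> coinv_ideal (p + q)
| CoinvIdealM r q : r \in R -> r@_0 = 0 -> coinv_ideal (r * q).

Lemma coinv_idealMl a p : coinv_ideal p -> coinv_ideal (a * p).
Proof.
elim=> [|q q' _ hq _ hq'|r q rR r0]; first by rewrite mulr0; exact: CoinvIdeal0.
- by rewrite mulrDr; apply: CoinvIdealD.
- by rewrite mulrCA; apply: CoinvIdealM.
Qed.

Lemma coinv_idealZ c p : coinv_ideal p -> coinv_ideal (c *: p).
Proof. by rewrite -mul_mpolyC; apply: coinv_idealMl. Qed.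

Lemma coinv_idealN p : coinv_ideal p -> coinv_ideal (- p).
Proof. by rewrite -scaleN1r; apply: coinv_idealZ. Qed.

Lemma coinv_idealB p q : coinv_ideal p -> coinv_ideal q -> coinv_ideal (p - q).
Proof. by move=> hp hq; apply/CoinvIdealD/coinv_idealN. Qed.

Lemma coinv_ideal_sum (J : finType) (F : J -> S) :
  (forall j, coinv_ideal (F j)) -> coinv_ideal (\sum_j F j).
Proof.
move=> hF; elim/big_ind: _ => [|p q|//]; first exact: CoinvIdeal0.
exact: CoinvIdealD.
Qed.

Lemma coinv_ideal_act g p : coinv_ideal p -> coinv_ideal (act g p).
Proof.
elim=> [|q q' _ hq _ hq'|r q rR r0].
- by rewrite raddf0; exact: CoinvIdeal0.
- by rewrite rmorphD; apply: CoinvIdealD.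
- by rewrite rmorphM /= (invariantsP _ rR); apply: CoinvIdealM.
Qed.

Lemma sub_reynolds_coinv p :
  (forall g, coinv_ideal (act g p - p)) -> coinv_ideal (p - reynolds p).
Proof.
move=> hp; rewrite -opprB; apply: coinv_idealN.
have -> : reynolds p - p = #|gT|%:R^-1 *: \sum_g (act g p - p).
  rewrite sumrB scalerBr sumr_const -scaler_nat scalerA mulVf ?scale1r //.
  exact: card_group_neq0.
by apply: coinv_idealZ; apply: coinv_ideal_sum.
Qed.

(** The elements fixing [p] modulo the ideal form a subgroup, because $ghp-p=g(hp-p)+(gp-p)$ and the
    ideal is stable under $G$. *)
Lemma coinv_gen (A : {set gT}) p : (<<A>> = [set: gT])%g ->
  (forall g, g \in A -> coinv_ideal (act g p - p)) ->
  forall g, coinv_ideal (act g p - p).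
Proof.
move=> genA hA; pose H := [set g | `[< coinv_ideal (act g p - p) >]].
have gH : group_set H.
  apply/group_setP; split=> [|g h].
    by rewrite inE sym_act1 subrr; apply/asboolP/CoinvIdeal0.
  rewrite !inE => /asboolP hg /asboolP hh; apply/asboolP.
  rewrite -sym_act_comp -(subrK (act g p) (act g (act h p))) -addrA.
  by rewrite -raddfB; apply: CoinvIdealD => //; apply: coinv_ideal_act.
have AH : (<<A>> \subset Group gH)%g.
  by rewrite gen_subG; apply/subsetP => g gA; rewrite inE; apply/asboolP/hA.
by move=> g; have := subsetP AH g; rewrite genA !inE => /(_ isT)/asboolP.
Qed.

End Invariants.

(** * Divided differences along reflections *)

Section Reflections.
Variables (C : numClosedFieldType) (n : nat).
Local Notation S := {mpoly C[n]}.
Implicit Types (p q : S) (M : 'M[C]_n).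

Lemma msize_msubst M p : (msize (msubst M p) <= msize p)%N.
Proof.
rewrite {1}[p]mpolyE linear_sum (leq_trans (msize_sum _ _ _)) //.
apply/bigmax_leqP_seq => m mp _; rewrite linearZ /=.
rewrite (leq_trans (msizeZ_le _ _)) // msizeE.
apply/bigmax_leqP_seq => m' m'p _.
rewrite (dhomogP _ _ _ (msubst_homogX M m) _ m'p).
exact: msize_mdeg_lt.
Qed.

(** A reflection differs from the identity by a rank one matrix, so it moves each variable by a
    multiple of one linear form [a] (size 2 means degree 1). Divisibility passes to products by
    $M(pq)-pq=(Mp-p)Mq+p(Mq-q)$. *)
Lemma reflection_root M : pseudo_reflection M ->
  exists2 a : S, msize a = 2%N & forall p, exists q, a * q = msubst M p - p.
Proof.
case=> zeta [P [n_gt0 _ _ uP ->]]; set D := diag_mx _.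
pose i0 := Ordinal n_gt0.
pose a : S := \sum_i P i i0 *: 'X_i; exists a.
  have ha : a \is 1.-homog.
    by rewrite rpred_sum // => i _; rewrite rpredZ // dhomogX /= mdeg1.
  have a0 : a != 0.
    apply: contraL uP => /eqP a0; rewrite unitmxE (expand_det_col _ i0) big1.
      by rewrite unitr0.
    move=> i _; suff -> : P i i0 = 0 by rewrite mul0r.
    have := congr1 (mcoeff U_(i)) a0; rewrite mcoeff0 raddf_sum (bigD1 i) //=.
    rewrite mcoeffZ mcoeffXU eqxx mulr1 big1 ?addr0 // => j ji.
    by rewrite mcoeffZ mcoeffXU (negbTE ji) mulr0.
  by rewrite -(mlead_deg a0) (dhomogP _ _ _ ha _ (mlead_supp a0)).
elim/mpoly_alg_ind=> [c|j|p q [p' hp] [q' hq]|p q [p' hp] [q' hq]].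
- by exists 0; rewrite msubstC subrr mulr0.
(* The rank one part is $\zeta-1$ times column [i0] of [P], which gives [a], times row [i0] of its
   inverse, which gives this scalar. *)
- exists ((zeta - 1) * invmx P i0 j)%:MP.
  have -> : P *m D *m invmx P =
    1%:M + (zeta - 1) *: (col i0 P *m row i0 (invmx P)).
    have -> : D = 1%:M + (zeta - 1) *: delta_mx i0 i0.
      apply/matrixP => i k; rewrite !mxE.
      have -> : (i == i0) = (i == 0%N :> nat) by rewrite -val_eqE.
      case: (eqVneq i k) => [<-|ne]; last first.
        rewrite !mulr0n add0r; case: eqP; rewrite ?mulr0 //= => i_0.
        by case: eqP => [k_0|]; rewrite ?mulr0 //; case/eqP: ne; apply: val_inj;
          rewrite k_0 /= i_0.
      rewrite -val_eqE /= !mulr1n.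
      case: eqP; rewrite /= ?mulr1 ?mulr0 ?addr0 //.
      by rewrite addrC subrK.
    rewrite mulmxDr mulmx1 mulmxDl mulmxV // -scalemxAr -scalemxAl.
    congr (_ + _ *: _); rewrite -(mul_delta_mx (0 : 'I_1)).
    by rewrite colE rowE !mulmxA.
  rewrite msubstX; under eq_bigr do rewrite mxE scalerDl.
  rewrite big_split /= -(msubstX 1%:M) msubst1 addrAC.
  rewrite subrr add0r mulrC mul_mpolyC scaler_sumr; apply: eq_bigr => i _.
  rewrite scalerA !mxE big_ord1 !mxE; congr (_ *: _).
  by rewrite mulrAC mulrA.
- by exists (p' + q'); rewrite mulrDr hp hq rmorphD opprD addrACA.
- exists (p' * msubst (P *m D *m invmx P) q + p * q').
  rewrite mulrDr mulrA hp mulrCA hq rmorphM /= mulrBl mulrBr.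
  by rewrite addrA subrK.
Qed.

End Reflections.

(** * Chevalley's freeness argument *)

Section Freeness.
Variables (C : numClosedFieldType) (n : nat) (gT : finGroupType).
Variable rG : mx_representation C [set: gT] n.
Hypothesis rG_refl : reflection_group rG.
Local Notation S := {mpoly C[n]}.
Local Notation act := (sym_act rG).
Local Notation R := (invariants rG).
Local Notation I := (coinv_ideal rG).

(* [s] lies in the submodule spanned by the [r i], [i \in T], over the local
   ring of the invariants at the origin. *)
Definition locally_spanned (J : finType) (T : {set J}) (r : J -> S) s :=
  exists t (c : J -> S), [/\ t \in R, t@_0 != 0, forall i, c i \in R
    & t * s = \sum_(i in T) c i * r i].

(** Induction on the size of [p j0]: divided differences are smaller, so [p j0] agrees with its
    average modulo the ideal. An average with nonzero constant term would turn the averaged relation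
    into a local expression of [r j0] by the others. *)
Lemma relation_coinv (J : finType) (j0 : J) (r p : J -> S) :
  (forall j, r j \in R) -> \sum_j r j * p j = 0 ->
  ~ locally_spanned [set~ j0] r (r j0) -> I (p j0).
Proof.
move=> rR rp0 min_j0; have [A hA genA] := rG_refl.
have [k] := ubnP (msize (p j0)).
elim: k p rp0 => // k IHk p rp0; rewrite ltnS => le_pk.
have [->|pj0] := eqVneq (p j0) 0; first exact: CoinvIdeal0.
(* The divided differences of the [p j] satisfy the same relation. *)
have Ip : I (p j0 - reynolds rG (p j0)).
  apply: sub_reynolds_coinv; apply: coinv_gen genA _ => g gA.
  have [a size_a div_a] := reflection_root (hA g gA).
  have [q hq] := choice (fun j => div_a (p j)).
  have a0 : a != 0 by rewrite -msize_poly_eq0 size_a.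
  rewrite sym_actE -hq; apply: coinv_idealMl; apply: IHk.
    apply: (mulfI a0); rewrite mulr0 mulr_sumr.
    under eq_bigr do rewrite mulrCA hq mulrBr.
    rewrite sumrB rp0 subr0.
    transitivity (act g (\sum_j r j * p j)); last by rewrite rp0 rmorph0.
    rewrite rmorph_sum.
    by apply: eq_bigr => j _; rewrite rmorphM /= (invariantsP _ _ (rR j)).
  have [->|q0] := eqVneq (q j0) 0.
    by rewrite msize0; apply: leq_trans le_pk; rewrite lt0n msize_poly_eq0.
  have := msizeM a0 q0; rewrite hq size_a add2n /= => size_q.
  apply: leq_trans le_pk; rewrite -size_q.
  by rewrite (leq_trans (msizeD_le _ _)) // msizeN geq_max msize_msubst leqnn.
rewrite -[p j0](subrK (reynolds rG (p j0))); apply: CoinvIdealD => //.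
have [c0|c0] := eqVneq (reynolds rG (p j0))@_0 0.
  by rewrite -[reynolds _ _]mulr1; apply: CoinvIdealM => //;
    apply: reynolds_invariant.
case: min_j0; exists (reynolds rG (p j0)), (fun j => - reynolds rG (p j)).
split=> // [|i|]; rewrite ?rpredN ?reynolds_invariant //.
have := reynolds_mulr p rR; rewrite rp0 /reynolds big1 ?scaler0; last first.
  by move=> g _; rewrite raddf0.
rewrite -/(reynolds rG _) (bigD1 j0) //= => /esym/eqP; rewrite addr_eq0 mulrC.
move=> /eqP ->; rewrite -sumrN; apply: eq_big => [i|i _].
  by rewrite !inE.
by rewrite mulNr mulrC.
Qed.

(** Substitute the expression of [r j0] into that of [s]; the product of the two denominators still
    has nonzero constant term. *)
Lemma locally_spanned_trans (J : finType) (T : {set J}) (j0 : J) r s :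
  locally_spanned T r s -> locally_spanned (T :\ j0) r (r j0) ->
  locally_spanned (T :\ j0) r s.
Proof.
move=> [t [c [tR t0 cR tE]]] [t' [c' [t'R t'0 c'R t'E]]].
have [j0T|j0T] := boolP (j0 \in T); last first.
  exists t, c; split=> //; rewrite tE; apply: eq_bigl => i.
  by rewrite !inE; case: eqP => // ->; rewrite (negbTE j0T).
exists (t' * t), (fun i => t' * c i + c j0 * c' i); split.
- exact: rpredM.
- by rewrite mcoeff0M mulf_neq0.
- by move=> i; rewrite rpredD ?rpredM.
rewrite -mulrA tE (big_setD1 j0) //= mulrDr mulrCA t'E !mulr_sumr -big_split.
by apply: eq_bigr => i _; rewrite /= mulrDl !mulrA addrC.
Qed.

(** Rewriting the relation in a minimal set of local generators puts each new cofactor [p j0] in the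
    ideal. Independence kills the constant terms of its coefficients, so [r j0] can be solved for in
    terms of the other generators. Hence the minimal set is empty. *)
Lemma coinv_independent_free (J : finType) (h r : J -> S) :
  (forall c : J -> C, I (\sum_j c j *: h j) -> forall j, c j = 0) ->
  (forall j, r j \in R) -> \sum_j r j * h j = 0 -> forall j, r j = 0.
Proof.
move=> indep rR rh0.
pose gen T := `[< forall j, locally_spanned T r (r j) >].
have gen_setT : gen setT.
  apply/asboolP => j; exists 1, (fun i => (i == j)%:R).
  split=> [||i|]; rewrite ?rpred1 ?rpred_nat // ?mcoeff1 ?eqxx ?oner_eq0 //.
  rewrite mul1r (bigD1 j) //= eqxx mul1r big1 ?addr0 // => i /andP[_].
  by move/negbTE ->; rewrite mul0r.
(* Nakayama: a minimal set [T] of local generators of the ideal of the [r j]. *)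
case: (arg_minnP (fun T : {set J} => #|T|) gen_setT) => T /asboolP genT minT.
have notmin j0 : j0 \in T -> ~ locally_spanned (T :\ j0) r (r j0).
  move=> j0T h0; suff /minT : gen (T :\ j0).
    by rewrite (cardsD1 j0 T) j0T ltnn.
  by apply/asboolP => j; apply: locally_spanned_trans (genT j) h0.
have [T0|[j0 j0T]] := set_0Vmem T.
  move=> j; have [t [c [_ t0 _]]] := genT j.
  rewrite T0 big_set0 => /eqP; rewrite mulf_eq0 => /orP[/eqP t_0|/eqP //].
  by rewrite t_0 mcoeff0 eqxx in t0.
have [t ht] := choice genT; have [c hc] := choice ht.
(* Multiplying by the product of all [t i] clears denominators; [tt j] is what remains after [t j]
   is used on [r j]. *)
pose tt j := \prod_(i | i != j) t i.
pose p i := \sum_j (tt j * c j i) * h j.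
pose r' i := if i \in T then r i else 0.
have tR j : t j \in R by case: (hc j).
have ttR j : tt j \in R by rewrite rpred_prod.
have r'R j : r' j \in R by rewrite /r'; case: ifP; rewrite ?rpred0.
have rp0 : \sum_i r' i * p i = 0.
  transitivity ((\prod_i t i) * \sum_j r j * h j); last by rewrite rh0 mulr0.
  rewrite mulr_sumr; under [LHS]eq_bigr => i _ do rewrite mulr_sumr.
  rewrite exchange_big; apply: eq_bigr => j _ /=.
  have -> : \prod_i t i = t j * tt j by rewrite (bigD1 j).
  have [_ _ _ tE] := hc j; rewrite mulrACA tE mulr_suml [RHS]big_mkcond.
  apply: eq_bigr => i _; rewrite /r'; case: ifP => _; last by rewrite mul0r.
  by rewrite [c j i * r i]mulrC -!mulrA; congr (_ * _); rewrite mulrCA.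
have Ip : I (p j0).
  apply: relation_coinv rp0 _ => // -[u [d [uR u0 dR]]].
  rewrite {1}/r' j0T => uE; apply: (notmin j0 j0T); exists u, d; split=> //.
  rewrite uE (bigID (mem T)) /= [X in _ + X]big1 ?addr0 => [|i]; last first.
    by case/andP=> _ /negbTE iT; rewrite /r' iT mulr0.
  apply: eq_big => [i|i /andP[_ iT]]; first by rewrite !inE.
  by rewrite /r' iT.
have c00 : (c j0 j0)@_0 = 0.
  have : (tt j0 * c j0 j0)@_0 = 0.
    apply: (indep (fun j => (tt j * c j j0)@_0)).
    (* Modulo the ideal, invariant coefficients may be replaced by their constant terms. *)
    have -> : \sum_j (tt j * c j j0)@_0 *: h j =
      p j0 - \sum_j (tt j * c j j0 - ((tt j * c j j0)@_0)%:MP) * h j.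
      rewrite -sumrB; apply: eq_bigr => j _.
      by rewrite mulrBl mul_mpolyC opprB addrC subrK.
    apply: coinv_idealB => //; apply: coinv_ideal_sum => j.
    have [_ _ cR _] := hc j.
    apply: CoinvIdealM; last by rewrite mcoeffB mcoeffC eqxx mulr1 subrr.
    rewrite rpredB ?rpredM // -alg_mpolyC rpredZ ?rpred1 //.
  rewrite mcoeff0M => /eqP; rewrite mulf_eq0 => /orP[|/eqP //].
  rewrite /tt rmorph_prod /= => /prodf_eq0[i _].
  by have [_ /negbTE -> _ _] := hc i.
case: (notmin j0 j0T); have [_ t0 cR tE] := hc j0.
(* Moving the [j0] term to the left keeps the denominator nonzero at the origin, since [c j0 j0]
   vanishes there. *)
exists (t j0 - c j0 j0), (c j0); split=> //; first by rewrite rpredB.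
  by rewrite mcoeffB c00 subr0.
by rewrite mulrBl tE (big_setD1 j0) //= addrAC subrr add0r.
Qed.

End Freeness.

(** * Dependence over the invariants *)

Section Rank.
Variables (C : numClosedFieldType) (n : nat) (gT : finGroupType).
Variable rG : mx_representation C [set: gT] n.
Local Notation S := {mpoly C[n]}.
Local Notation act := (sym_act rG).
Local Notation R := (invariants rG).

(* The coefficients of an [S]-linear dependency between the vectors
   [(g (y j))_g] are averaged over [G]; the factor [a] turns one of them into a
   norm, so that its average is nonzero. *)
Lemma invariant_relation (y : option gT -> S) :
  exists r : option gT -> S, [/\ forall j, r j \in R, exists j, r j != 0
    & \sum_j r j * y j = 0].
Proof.
(* The column [None] is zero padding: it makes the matrix square and singular. *)
pose A : 'M[S]_#|{: option gT}| := \matrix_(i, j)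
  if enum_val j is Some g then act g (y (enum_val i)) else 0.
have : \det A == 0.
  rewrite (expand_det_col _ (enum_rank None)) big1 // => i _.
  by rewrite mxE enum_rankK mul0r.
case/det0P=> v v0 vA; pose c j := v 0 (enum_rank j).
have cE g : \sum_j c j * act g (y j) = 0.
  have /matrixP/(_ 0 (enum_rank (Some g))) := vA; rewrite !mxE => E.
  rewrite -[RHS]E (reindex _ (onW_bij _ (enum_val_bij _))) /=.
  by apply: eq_bigr => i _; rewrite /c enum_valK !mxE enum_rankK.
have [j0 cj0] : exists j, c j != 0.
  have [i vi] : exists i, v 0 i != 0 by apply/rV0Pn.
  by exists (enum_val i); rewrite /c enum_valK.
pose a := \prod_(h | h != 1%g) act h (c j0).
exists (fun j => \sum_h act h (a * c j)); split.
- by move=> j; apply: sum_orbit_invariant.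
- exists j0; pose N := \prod_h act h (c j0).
  have N0 : N != 0.
    apply/prodf_neq0 => h _; rewrite -(rmorph0 (sym_act rG h)).
    by rewrite (inj_eq (@sym_act_inj _ _ _ _ h)).
  have -> : a * c j0 = N by rewrite /N (bigD1 1%g) //= sym_act1 mulrC.
  rewrite (eq_bigr (fun=> N)) => [|h _].
    rewrite sumr_const -scaler_nat mscalerI negb_or N0 andbT.
    exact: card_group_neq0.
  by have /invariantsP := prod_orbit_invariant rG (c j0); apply.
under eq_bigr do rewrite mulr_suml.
rewrite exchange_big big1 //= => h _.
(* The summand at [h] is the image under [h] of [a] times the dependency at $h^{-1}$. *)
transitivity (act h (a * \sum_j c j * act h^-1%g (y j))); last first.
  by rewrite cE mulr0 rmorph0.
rewrite mulr_sumr rmorph_sum; apply: eq_bigr => j _ /=.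
by rewrite mulrA [in RHS]rmorphM /= sym_act_comp mulgV sym_act1.
Qed.

End Rank.

(** * Harmonic polynomials modulo the coinvariant ideal *)

Section Unitarization.
Variables (C : numClosedFieldType) (n : nat).
Local Notation cj := (map_mx (@Num.conj C)).

(** The sum is Hermitian, and positive definite thanks to its identity term. Unitary diagonalization
    and square roots of the eigenvalues provide [P]. *)
Lemma gram_sum_factor (J : finType) (B : J -> 'M[C]_n) (j0 : J) :
  B j0 = 1%:M ->
  exists2 P : 'M[C]_n, P \in unitmx & \sum_j (B j)^T *m cj (B j) = P^T *m cj P.
Proof.
move=> Bj0; set H := \sum_j _.
have HH : H \is hermsymmx.
  apply/is_hermitianmxP; rewrite expr0 scale1r /H !raddf_sum /=.
  apply: eq_bigr => j _; rewrite trmx_mul map_mxM /= trmxK -map_trmx.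
  rewrite -[cj (cj _)]map_mx_comp [map_mx (_ \o _) _]map_mx_id // => z.
  by rewrite /= conjCK.
have /hermitian_normalmx/orthomx_spectralP HE := HH.
have uU := spectral_unitarymx H.
move: HE uU; set U := spectralmx H; set d := spectral_diag H => HE uU.
(* Each eigenvalue is the value of the form at a row of [U], hence positive. *)
have dE i : d 0 i = (row i U *m H *m cj (row i U)^T) 0 0.
  have : diag_mx d = U *m H *m cj U^T.
    rewrite HE invmx_unitary // !mulmxA (unitarymxP uU) mul1mx.
    by rewrite -mulmxA (unitarymxP uU) mulmx1.
  move=> /matrixP/(_ i i); rewrite mxE eqxx mulr1n => ->.
  by rewrite -!row_mul !mxE; apply: eq_bigr => k _; rewrite !mxE.
have d_gt0 i : 0 < d 0 i.
  rewrite dE /H mulmx_sumr mulmx_suml summxE (bigD1 j0) //= ltr_wpDr //.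
    apply: sumr_ge0 => j _; rewrite mulmxA -mulmxA mxE.
    apply: sumr_ge0 => k _.
    suff -> : (cj (B j) *m cj (row i U)^T) k 0 = ((row i U *m (B j)^T) 0 k)^*.
      by rewrite -normCK exprn_ge0.
    rewrite !mxE rmorph_sum; apply: eq_bigr => l _.
    by rewrite !mxE rmorphM mulrC.
  rewrite Bj0 trmx1 map_mx1 mulmx1 mulmx1.
  have /matrixP/(_ i i) := unitarymxP uU.
  rewrite [RHS]mxE eqxx mulr1n !mxE => E.
  suff -> : \sum_j row i U 0 j * cj (row i U)^T j 0 = 1 by exact: ltr01.
  by rewrite -E; apply: eq_bigr => k _; rewrite !mxE.
pose s := \row_i sqrtC (d 0 i).
have s_unit : diag_mx s \in unitmx.
  rewrite unitmxE det_diag unitfE; apply/prodf_neq0 => i _.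
  by rewrite mxE sqrtC_eq0 gt_eqF.
exists (diag_mx s *m cj U).
  rewrite unitmx_mul s_unit /= unitmxE det_map_mx unitfE fmorph_eq0 -unitfE.
  by rewrite -unitmxE unitarymx_unit.
rewrite HE invmx_unitary // trmx_mul tr_diag_mx map_mxM /= map_diag_mx.
rewrite -[cj (cj U)]map_mx_comp [map_mx (_ \o _) U]map_mx_id; last first.
  by move=> z; rewrite /= conjCK.
rewrite -map_trmx !mulmxA; congr (_ *m _); rewrite -!mulmxA; congr (_ *m _).
rewrite mulmx_diag; congr diag_mx; apply/rowP => i; rewrite !mxE.
by rewrite -normCK ger0_norm ?sqrtCK // sqrtC_ge0 ltW.
Qed.

(** Averaging the standard Hermitian form: right translation by a group element only permutes the
    summands. *)
Lemma invariant_gram (gT : finGroupType)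
    (rG : mx_representation C [set: gT] n) :
  exists2 P : 'M[C]_n, P \in unitmx &
    forall g, (rG g)^T *m (P^T *m cj P) *m cj (rG g) = P^T *m cj P.
Proof.
have [P uP PE] := gram_sum_factor (repr_mx1 rG); exists P => // h.
rewrite -PE mulmx_sumr mulmx_suml [RHS](reindex_inj (mulIg h)) /=.
by apply: eq_bigr => g _; rewrite repr_mxM ?inE // trmx_mul map_mxM !mulmxA.
Qed.

End Unitarization.

(** * The Fischer product *)

Section Fischer.
Variables (C : numClosedFieldType) (n : nat).
Local Notation S := {mpoly C[n]}.
Local Notation cj := (map_mx (@Num.conj C)).
Local Notation cjp := (map_mpoly (@Num.conj C)).
Implicit Types (p q u : S) (M P : 'M[C]_n).

Lemma map_mpoly_msubst M p : cjp (msubst M p) = msubst (cj M) (cjp p).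
Proof.
elim/mpoly_alg_ind: p => [c|j|p q IHp IHq|p q IHp IHq].
- by rewrite msubstC !map_mpolyC msubstC.
- rewrite map_mpolyX !msubstX raddf_sum; apply: eq_bigr => i _.
  by rewrite /= map_mpolyZ map_mpolyX mxE.
- by rewrite !rmorphD /= IHp IHq.
- by rewrite !rmorphM /= IHp IHq.
Qed.

(* The constant term of [conj(p)(d) p] is the sum of the [m! |p_m|^2]. *)
Lemma fischer_eq0 p : (dop (cjp p) p)@_0 = 0 -> p = 0.
Proof.
pose w (m : 'X_{1..n}) := (\prod_(i < n) (m i)^_(m i))%N.
have w_gt0 m : (0 < w m)%N by apply: prodn_gt0 => i; rewrite ffact_gt0.
rewrite (@dopwE _ _ (maxn (msize (cjp p)) (msize p))) ?leq_maxl //.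
rewrite raddf_sum /= => /eqP.
have E (m : 'X_{1..n < maxn (msize (cjp p)) (msize p)}) :
    ((cjp p)@_m *: p^`M[m])@_0 = `|p@_m| ^+ 2 *+ w m.
  rewrite mcoeffZ mcoeff_map_mpoly mcoeff_mderivm addm0 mulrnAr.
  by rewrite mulrC -normCK.
under eq_bigr do rewrite E.
rewrite psumr_eq0 => [/allP p0|m _]; last by rewrite mulrn_wge0 ?exprn_ge0.
apply/mpolyP => m; rewrite mcoeff0.
have [mk|mk] := ltnP (mdeg m) (maxn (msize (cjp p)) (msize p)); last first.
  apply/memN_msupp_eq0/msize_mdeg_ge.
  by rewrite (leq_trans _ mk) ?leq_maxr.
have := p0 (BMultinom mk) (mem_index_enum _).
by rewrite /= mulrn_eq0 eqn0Ngt w_gt0 /= sqrf_eq0 normr_eq0 => /eqP.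
Qed.

End Fischer.

(** * Harmonic polynomials meet the coinvariant ideal trivially *)

Section Harmonics.
Variables (C : numClosedFieldType) (n : nat) (gT : finGroupType).
Variable rG : mx_representation C [set: gT] n.
Local Notation S := {mpoly C[n]}.
Local Notation act := (sym_act rG).
Local Notation R := (invariants rG).
Local Notation I := (coinv_ideal rG).
Local Notation cj := (map_mx (@Num.conj C)).
Local Notation cjp := (map_mpoly (@Num.conj C)).
Variable f : n.-tuple S.
Hypothesis f_inv : forall i, tnth f i \in R.
Hypothesis f_homog : forall i, exists d, tnth f i \is d.-homog.
Local Notation J := (jacobian f).

(** Differentiate $f_i=g f_i$ by the chain rule and take determinants. *)
Lemma jacobian_act g : J = \det (rG g) *: act g J.
Proof.
rewrite /jacobian sym_actE -det_map_mx -mul_mpolyC.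
rewrite -[(\det _)%:MP](det_map_mx (mpolyC n (R := C))) mulrC.
rewrite -[X in _ * X]det_tr -det_mulmx; congr determinant.
apply/matrixP => i k; rewrite !mxE.
rewrite -[tnth f i in LHS](invariantsP _ _ (f_inv i) g) sym_actE.
rewrite mderiv_msubst linear_sum; apply: eq_bigr => j _ /=.
by rewrite !mxE linearZ /= mulrC mul_mpolyC.
Qed.

(** Truncated subtraction is harmless: past degree [d] the derivative is zero. *)
Lemma dhomog_mderivm m d p : p \is d.-homog ->
  (p : S)^`M[m] \is (d - mdeg m).-homog.
Proof.
move=> /dhomogP hp; apply/dhomogP => m'; rewrite mcoeff_msupp mcoeff_mderivm.
have [pm|/memN_msupp_eq0 ->] := boolP ((m + m')%MM \in msupp p); last first.
  by rewrite mul0rn eqxx.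
by rewrite -(hp _ pm) /= mdegD addKn.
Qed.

Lemma jacobian_homog : exists D, J \is D.-homog.
Proof.
have [d hd] := choice f_homog; exists (\sum_i (d i - 1))%N.
rewrite /jacobian rpred_sum // => s _.
have -> (b : bool) p : (-1) ^+ b * p = (-1) ^+ b *: p :> S.
  by case: b; rewrite ?expr0 ?mul1r ?scale1r // expr1 mulN1r scaleN1r.
rewrite rpredZ //; elim/big_rec2: _ => [|i k p _ hp]; first exact: dhomog1.
by apply: dhomogM => //; rewrite mxE -mderivmU1m -(mdeg1 (s i)) dhomog_mderivm.
Qed.

Lemma harmonicD u v : harmonic f u -> harmonic f v -> harmonic f (u + v).
Proof.
move=> /harmonicP[p ->] /harmonicP[q ->]; apply/harmonicP.
by exists (p + q); rewrite dopD.
Qed.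

Lemma harmonicZ c u : harmonic f u -> harmonic f (c *: u).
Proof.
move=> /harmonicP[p ->]; apply/harmonicP.
by exists (c *: p); rewrite dopZ.
Qed.

Lemma harmonic_sum (T : finType) (F : T -> S) :
  (forall j, harmonic f (F j)) -> harmonic f (\sum_j F j).
Proof.
move=> hF; elim/big_ind: _ => // [|u v]; last exact: harmonicD.
by apply/harmonicP; exists 0; rewrite dop0.
Qed.

(** As the Jacobian is homogeneous, a component of $p(\partial)J$ comes from keeping only the
    monomials of [p] of the matching degree. *)
Lemma pihomog_harmonic d u : harmonic f u -> harmonic f (pihomog mdeg d u).
Proof.
move=> /harmonicP[p ->]; have [D hJ] := jacobian_homog; apply/harmonicP.
exists (\sum_(m <- msupp p)
  (if (D - mdeg m == d)%N then p@_m else 0) *: 'X_[m]).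
rewrite linear_sum dop_sum; apply: eq_bigr => m _ /=.
rewrite linearZ dopZ dopXm /=; have hm := dhomog_mderivm m hJ.
case: eqP => [<-|/eqP ne]; first by rewrite pihomog_dE.
by rewrite (pihomog_ne0 ne hm) scaler0 scale0r.
Qed.

Variable x : S.
Hypothesis x_basis : is_basis (harmonic f) (fun g : gT => act g x).

(** Multiplicity one in the regular representation: $G$ permutes the orbit basis, so the coordinate
    of [u] at the identity determines all others. *)
Lemma skew_harmonic (chi : gT -> C) u : harmonic f u ->
  (forall g, act g u = chi g *: u) ->
  exists c, u = c *: \sum_g chi g^-1%g *: act g x.
Proof.
have [_ x_free x_span] := x_basis.
move=> /x_span[c uE] chi_u; exists (c 1%g).
rewrite scaler_sumr {1}uE; apply: eq_bigr => g _; rewrite scalerA.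
congr (_ *: _); apply/eqP; rewrite -subr_eq0; apply/eqP.
pose h := g^-1%g.
(* These are the coordinates of $hu-\chi(h)u=0$. *)
have := x_free (fun k => c (h^-1 * k)%g - c k * chi h) _ 1%g.
rewrite /= mulg1 invgK mulrC => -> //.
under eq_bigr do rewrite scalerBl.
rewrite sumrB; apply/eqP; rewrite subr_eq0; apply/eqP.
transitivity (act h u); last first.
  rewrite chi_u {1}uE scaler_sumr; apply: eq_bigr => k _.
  by rewrite scalerA mulrC.
rewrite uE linear_sum /= [LHS](reindex_inj (mulgI h)) /=.
by apply: eq_bigr => k _; rewrite /h mulKVg linearZ /= sym_act_comp.
Qed.

Lemma jacobian_neq0 : J != 0.
Proof.
have [x_harm x_free _] := x_basis; apply/eqP => J0.
have act0 g : act g x = 0.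
  by have /harmonicP[p ->] := x_harm g; rewrite J0 raddf0.
have := x_free (fun=> 1) _ 1%g; rewrite big1 => [/(_ erefl)/eqP|g _].
  by rewrite oner_eq0.
by rewrite act0 scaler0.
Qed.

(** Both $p(\partial)J$ and $J$ have the inverse determinant character, so they are proportional;
    the drop in degree makes the factor zero. *)
Lemma dop_jacobian_eq0 p : p@_0 = 0 ->
  (forall g, msubst (rG g)^T p = p) -> dop p J = 0.
Proof.
move=> p0 p_inv; pose chi g := (\det (rG g))^-1.
have chiJ g : act g J = chi g *: J.
  rewrite {2}(jacobian_act g) scalerA mulVf ?scale1r // -unitfE -unitmxE.
  exact: repr_mx_unit.
have [c JE] : exists c, J = c *: \sum_g chi g^-1%g *: act g x.
  apply: skew_harmonic chiJ; apply/harmonicP; exists 1.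
  by rewrite -mpolyC1 dopC scale1r.
have [d pJE] : exists d, dop p J = d *: \sum_g chi g^-1%g *: act g x.
  apply: skew_harmonic => [|g]; first by apply/harmonicP; exists p.
  by rewrite sym_actE -{1}[p](p_inv g) -dop_msubst -sym_actE chiJ linearZ.
have c0 : c != 0.
  by apply: contraNneq jacobian_neq0 => c0; rewrite JE c0 scale0r.
have E : dop p J = (d / c) *: J by rewrite pJE {1}JE scalerA divfK.
have := dop_lower p0 jacobian_neq0; rewrite E.
have [->|dc] := eqVneq (d / c) 0; first by rewrite scale0r.
by rewrite msizeZ // ltnn.
Qed.

Lemma harmonic_coinv_eq0 u : harmonic f u -> I u -> u = 0.
Proof.
move=> harm_u Iu; have [P uP PP] := invariant_gram rG.
(* Orthogonality for the Fischer product in the coordinates given by [P]; taking [q] equal to [u]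
   then gives [u = 0] by definiteness. *)
suff orth q : I q -> (dop (cjp (msubst P q)) (msubst P u))@_0 = 0.
  by apply: (msubst_inj uP); rewrite rmorph0; apply/fischer_eq0/orth.
elim=> [|p q' _ hp _ hq|r q' rR r0].
- by rewrite !rmorph0 dop0 mcoeff0.
- by rewrite !rmorphD dopD mcoeffD hp hq addr0.
rewrite !rmorphM /= mulrC dopM dop_msubst.
set p := msubst P^T _; suff -> : dop p u = 0 by rewrite !raddf0.
(* Substituting the invariant Gram matrix turns the conjugate of an invariant into a symbol fixed by
   the transposed action. *)
have pE : p = msubst (P^T *m cj P) (cjp r).
  by rewrite /p map_mpoly_msubst msubst_comp.
have pJ : dop p J = 0.
  apply: dop_jacobian_eq0 => [|g].
    rewrite pE msubst_mcoeff0 mcoeff_map_mpoly r0; exact: conjC0.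
  rewrite pE -{1}(invariantsP _ _ rR g) sym_actE map_mpoly_msubst.
  by rewrite !msubst_comp PP.
(* Constant coefficient operators commute, so killing the Jacobian kills every harmonic
   polynomial. *)
by have /harmonicP[eta ->] := harm_u; rewrite -dopM mulrC dopM pJ raddf0.
Qed.

End Harmonics.

(** * The basis of [S] over the invariants *)

Section HarmonicBasis.
Variables (C : numClosedFieldType) (n : nat) (gT : finGroupType).
Variable rG : mx_representation C [set: gT] n.
Hypothesis rG_refl : reflection_group rG.
Local Notation S := {mpoly C[n]}.
Local Notation act := (sym_act rG).
Local Notation R := (invariants rG).
Local Notation I := (coinv_ideal rG).
Variable f : n.-tuple S.
Hypothesis f_inv : forall i, tnth f i \in R.
Hypothesis f_homog : forall i, exists d, tnth f i \is d.-homog.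
Variable x : S.
Hypothesis x_basis : is_basis (harmonic f) (fun g : gT => act g x).

Lemma harmonic_coinv_independent (c : gT -> C) :
  I (\sum_g c g *: act g x) -> forall g, c g = 0.
Proof.
have [x_harm x_free _] := x_basis => Ic; apply: x_free.
apply: (harmonic_coinv_eq0 f_inv x_basis) Ic.
by apply: harmonic_sum => g; apply: harmonicZ.
Qed.

Lemma harmonic_free (r : gT -> S) : (forall g, r g \in R) ->
  \sum_g r g * act g x = 0 -> forall g, r g = 0.
Proof.
exact: (coinv_independent_free rG_refl harmonic_coinv_independent).
Qed.

(** The orbit of [x] together with [p] has $|G|+1$ members, hence is dependent over the invariants,
    hence over the scalars modulo the ideal. There [p] has a nonzero coefficient, as the orbit alone
    is independent. *)
Lemma coinv_harmonic_sum p : exists q u, [/\ I q, harmonic f u & p = q + u].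
Proof.
have [x_harm _ _] := x_basis.
pose y (j : option gT) := if j is Some g then act g x else p.
have sum_option (V : nmodType) (F : option gT -> V) :
    \sum_j F j = F None + \sum_g F (Some g).
  rewrite (bigD1 None) //=; congr (_ + _).
  rewrite (reindex_omap Some id) => [|[]//].
  by apply: eq_bigl => g; rewrite eqxx.
have [r [rR [j0 rj0] ry0]] := invariant_relation rG y.
have [c Icy [j1 cj1]] : exists2 c : option gT -> C,
    I (\sum_j c j *: y j) & exists j, c j != 0.
  apply: contrapT => no_c; move/eqP: rj0; apply.
  apply: (coinv_independent_free rG_refl _ rR ry0) => c Ic j.
  by apply: contrapT => /eqP cj; apply: no_c; exists c; last by exists j.
rewrite sum_option /= in Icy.
have cN : c None != 0.
  apply/eqP => cN; rewrite cN scale0r add0r in Icy.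
  have c0 := harmonic_coinv_independent Icy.
  by case: j1 cj1 => [g|]; rewrite ?cN ?c0 eqxx.
exists ((c None)^-1 *: (c None *: p + \sum_g c (Some g) *: act g x)).
exists ((c None)^-1 *: - \sum_g c (Some g) *: act g x).
split; first exact: coinv_idealZ.
  apply: harmonicZ; rewrite -scaleN1r; apply: harmonicZ.
  by apply: harmonic_sum => g; apply: harmonicZ.
by rewrite -scalerDr addrK scalerA mulVf // scale1r.
Qed.

Definition harmonic_spanned p :=
  exists2 r : gT -> S, forall g, r g \in R & p = \sum_g r g * act g x.

Lemma harmonic_spannedD p q :
  harmonic_spanned p -> harmonic_spanned q -> harmonic_spanned (p + q).
Proof.
move=> [r rR ->] [s sR ->]; exists (fun g => r g + s g).
  by move=> g; rewrite rpredD.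
by rewrite -big_split; apply: eq_bigr => g _; rewrite /= mulrDl.
Qed.

Lemma harmonic_spannedM r p :
  r \in R -> harmonic_spanned p -> harmonic_spanned (r * p).
Proof.
move=> rR [s sR ->]; exists (fun g => r * s g).
  by move=> g; rewrite rpredM.
by rewrite mulr_sumr; apply: eq_bigr => g _; rewrite /= mulrA.
Qed.

Lemma harmonic_spanned0 : harmonic_spanned 0.
Proof.
exists (fun=> 0); first by move=> g; rewrite rpred0.
by rewrite big1 // => g _; rewrite mul0r.
Qed.

(** Strong induction on the degree of a component: modulo a harmonic part it is a sum of products of
    a positive degree invariant with a polynomial of smaller degree. *)
Lemma harmonic_spanning p : harmonic_spanned p.
Proof.
suff span_homog d : harmonic_spanned (pihomog mdeg d p).
  rewrite (pihomog_partitionE (leqnn (msize p))).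
  elim/big_ind: _ => // [|q q']; first exact: harmonic_spanned0.
  exact: harmonic_spannedD.
elim/ltn_ind: d p => d IHd p.
have [q [u [Iq hu ->]]] := coinv_harmonic_sum p.
rewrite raddfD /=; apply: harmonic_spannedD; last first.
  have [_ _ x_span] := x_basis.
  have [c ->] := x_span _ (pihomog_harmonic f_homog d hu).
  exists (fun g => (c g)%:MP) => [g|]; last first.
    by apply: eq_bigr => g _; rewrite mul_mpolyC.
  by rewrite -alg_mpolyC rpredZ ?rpred1.
elim: Iq => [|q1 q2 _ h1 _ h2|r q' rR r0].
- by rewrite raddf0; apply: harmonic_spanned0.
- by rewrite raddfD; apply: harmonic_spannedD.
rewrite (pihomog_partitionE (leqnn (msize r))).
rewrite (pihomog_partitionE (leqnn (msize q'))).
rewrite mulr_suml raddf_sum /=.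
elim/big_ind: _ => [|? ?|a _];
  [exact: harmonic_spanned0|exact: harmonic_spannedD|].
rewrite mulr_sumr raddf_sum /=.
elim/big_ind: _ => [|? ?|b _];
  [exact: harmonic_spanned0|exact: harmonic_spannedD|].
have hab := dhomogM (pihomogP mdeg a r) (pihomogP mdeg b q').
have [abd|ne] := eqVneq (a + b)%N d; last first.
  by rewrite (pihomog_ne0 ne hab); apply: harmonic_spanned0.
rewrite pihomog_dE -?abd //.
have [a0|a0] := posnP a; last first.
  apply: harmonic_spannedM; first exact: pihomog_invariant.
  by apply: IHd; rewrite -abd -[X in (X < _)%N]add0n ltn_add2r.
(* In degree 0 the component of [r] is its constant term, which is zero. *)
suff -> : pihomog mdeg a r = 0 by rewrite mul0r; apply: harmonic_spanned0.
apply/mpolyP => m; rewrite mcoeff0; have ha := pihomogP mdeg a r.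
have [m0|m0] := eqVneq m 0%MM; last first.
  by rewrite (dhomog_nemf_coeff ha) // a0 mdeg_eq0.
rewrite m0; transitivity (\sum_(e < msize r) (pihomog mdeg e r)@_0); last first.
  by rewrite -raddf_sum -pihomog_partitionE.
rewrite (bigD1 a) //= big1 ?addr0 // => b' ne.
rewrite (dhomog_nemf_coeff (pihomogP mdeg b' r)) //= mdeg0 eq_sym -a0.
by apply: contraNneq ne => /val_inj ->.
Qed.

(** Coordinates in the orbit basis are linear over the invariants, so they lift to the tensor
    product and detect independence. For spanning, invariant coefficients move across the tensor
    sign. *)
Lemma tensor_basis : is_basis (fun _ => True)
  (fun h : gT => tens R 1 (act h^-1%g x)).
Proof.
have spanP p : exists r : gT -> S,
    (forall g, r g \in R) /\ p = \sum_g r g * act g x.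
  by have [r rR pE] := harmonic_spanning p; exists r.
have [coord hcoord] := choice spanP.
have coordE p r : (forall g, r g \in R) -> p = \sum_g r g * act g x ->
    forall g, coord p g = r g.
  move=> rR pE g; have [cR cE] := hcoord p; apply/eqP; rewrite -subr_eq0.
  apply/eqP; apply: (harmonic_free (r := fun g => coord p g - r g)).
    by move=> k; rewrite rpredB.
  under eq_bigr do rewrite mulrBl.
  by rewrite sumrB -cE -pE subrr.
pose psi p : {ffun gT -> S^o} := [ffun g => coord p g : S^o].
have psiD : {morph psi : p q / p + q}.
  move=> p q; apply/ffunP => g; rewrite !ffunE.
  apply: (coordE _ (fun k => coord p k + coord q k)).
    by move=> k; rewrite rpredD // (hcoord _).1.
  rewrite {1}(hcoord p).2 {1}(hcoord q).2 -big_split.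
  by apply: eq_bigr => k _; rewrite /= mulrDl.
have psiZ r p : r \in R -> psi (r * p) = r *: psi p.
  move=> rR; apply/ffunP => g; rewrite !ffunE.
  apply: (coordE _ (fun k => r * coord p k)).
    by move=> k; rewrite rpredM // (hcoord _).1.
  by rewrite {1}(hcoord p).2 mulr_sumr; apply: eq_bigr => k _; rewrite mulrA.
have psix h g : psi (act h x) g = (g == h)%:R.
  rewrite ffunE; apply: (coordE _ (fun k => (k == h)%:R)).
    by move=> k; rewrite rpred_nat.
  rewrite (bigD1 h) //= eqxx mul1r big1 ?addr0 // => k /negbTE ->.
  by rewrite mul0r.
split=> // [c c0 h|m _].
  have lift_lin := tensor_lift_linear psiD psiZ.
  have lift0 : tensor_lift psi (0 : tensor R) = 0.
    by have := lift_lin (-1) 0 0; rewrite scaler0 addr0 scaleN1r addNr.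
  have E : tensor_lift psi (\sum_k c k *: tens R 1 (act k^-1%g x)) =
           \sum_k c k *: psi (act k^-1%g x).
    elim/big_rec2: _ => [//|k t u _ <-]; rewrite lift_lin; congr (_ *: _ + _).
    by rewrite (tensor_lift_tens psiD psiZ) scale1r.
  (* The basis vector at [h] involves $h^{-1}x$, so [c h] is read off at $h^{-1}$. *)
  have := congr1 (fun F : {ffun gT -> S^o} => F h^-1%g) E.
  rewrite c0 lift0 sum_ffunE ffunE (bigD1 h) //= big1 ?addr0 => [|k kh].
    by rewrite ffunE psix eqxx => /esym; rewrite [_ *: _]mulr1.
  by rewrite ffunE psix (inj_eq invg_inj) eq_sym (negbTE kh) scaler0.
pose span t := exists c : gT -> S, t = \sum_k c k *: tens R 1 (act k^-1%g x).
have spanD t u : span t -> span u -> span (t + u).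
  move=> [c ->] [d ->]; exists (fun k => c k + d k).
  by rewrite -big_split; apply: eq_bigr => k _; rewrite /= scalerDl.
have span0 : span 0.
  by exists (fun=> 0); rewrite big1 // => k _; rewrite scale0r.
have spanZ a t : span t -> span (a *: t).
  move=> [c ->]; exists (fun k => a * c k); rewrite scaler_sumr.
  by apply: eq_bigr => k _; rewrite scalerA.
suff span_tens a b : span (tens R a b).
  suff span_pi u : span (tensor_pi R u).
    by rewrite -[m]tensor_piK; apply: span_pi.
  rewrite -[u]freeg_sumE; elim/big_rec: _ => [|b v _ hv]; last first.
    by rewrite tensor_piD; apply: spanD => //; apply: span_tens.
  suff -> : tensor_pi R 0 = 0 by [].
  by apply: (addrI (tensor_pi R 0)); rewrite -tensor_piD !addr0.
rewrite tensE; apply: spanZ; have [bR ->] := hcoord b.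
have -> : tens R 1 (\sum_g coord b g * act g x) =
          \sum_g tens R 1 (coord b g * act g x).
  apply: (big_morph (tens R 1)) => [p q|]; first exact: tensDr.
  have := tensDr R 1 0 0; rewrite addr0 => /eqP.
  by rewrite -{1}[tens R 1 0]addr0 (inj_eq (addrI _)) eq_sym => /eqP.
exists (fun k => coord b k^-1%g); rewrite [RHS](reindex_inj invg_inj) /=.
apply: eq_bigr => g _; rewrite invgK -(tens_balanced 1 _ (bR g)) mul1r.
exact: tensE.
Qed.

End HarmonicBasis.

(** * The matrix of $\varphi$ *)

Lemma delta_basis (C : fieldType) (n : nat) (gT : finGroupType) :
  is_basis (fun _ => True) (@delta C n gT).
Proof.
have sum_delta (c : gT -> {mpoly C[n]}) h : (\sum_i c i *: delta C n i) h = c h.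
  rewrite sum_ffunE (bigD1 h) //= big1 ?addr0 => [|i ih].
    by rewrite !ffunE eqxx [_ *: _]mulr1.
  by rewrite !ffunE eq_sym (negbTE ih) scaler0.
split=> // [c c0 i|m _]; first by rewrite -sum_delta c0 ffunE.
by exists m; apply/ffunP => h; rewrite sum_delta.
Qed.

Lemma group_matrix_evalE (C : fieldType) n (gT : finGroupType)
    (y : gT -> {mpoly C[n]}) g h : group_matrix_eval y g h = y (g * h^-1)%g.
Proof.
rewrite /group_matrix_eval /group_matrix comp_mpolyXU -tnth_nth tnth_mktuple.
by rewrite enum_rankK.
Qed.

Theorem proposition3p19 (R : realType) (n : nat) (gT : finGroupType)
    (rG : mx_representation R[i] [set: gT] n)
    (rG_faithful : mx_faithful rG) (rG_refl : reflection_group rG)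
    (f : n.-tuple {mpoly R[i][n]}) (f_basic : basic_invariants rG f)
    (x : {mpoly R[i][n]}) (x_harmonic : harmonic f x)
    (x_basis : is_basis (harmonic f) (fun g : gT => sym_act rG g x)) :
  let X := group_matrix_eval (fun g : gT => sym_act rG g x) in
  is_matrix_of (phi rG)
    (fun h : gT => tens (invariants rG) 1 (sym_act rG h^-1%g x))
    (@delta R[i] n gT) X
  /\ forall g h : gT, X g h = sym_act rG (g * h^-1)%g x.
Proof.
move=> X; have XE g h : X g h = sym_act rG (g * h^-1)%g x.
  exact: group_matrix_evalE.
split=> //; have [f_homog f_inv _ _] := f_basic.
split; [|exact: delta_basis|].
  exact: (tensor_basis rG_refl f_inv f_homog x_basis).
(* At [g] the image of the [j]-th basis vector is $g(j^{-1}x)=(gj^{-1})x$, and only [delta g]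
   contributes there. *)
move=> j; apply/ffunP => g; rewrite phiE mul1r.
rewrite sum_ffunE (bigD1 g) //= big1 ?addr0 => [|i ig].
  by rewrite !ffunE eqxx [_ *: _]mulr1 XE sym_act_comp.
by rewrite !ffunE eq_sym (negbTE ig) scaler0.
Qed.
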